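(* Let $G$ be a finite group with identity element $e$. Then the following are equivalent: (i) $\mathcal I(G)$ is bipartite; (ii) $L(G)-\{G,e\}\cong\mathcal I(G)$ as graphs; (iii) the height of $L(G)$ is either $2$ or $3$.
   Context: For a finite group $G$, the inclusion graph of subgroups $\mathcal I(G)$ is the simple graph whose vertices are the proper subgroups of $G$, where ''proper'' means different from both the trivial subgroup and $G$ itself; two distinct vertices $H,K$ are adjacent if and only if $H\subset K$ or $K\subset H$. Graphs are understood to have a nonempty vertex set, so $G$ is assumed to have at least one subgroup different from $\{e\}$ and $G$. $L(G)$ is the subgroup lattice of $G$; viewed as a graph it is the Hasse diagram (the vertices are all subgroups, and $H,K$ are adjacent when one is a maximal subgroup of the other), and $L(G)-\{G,e\}$ is the graph obtained by deleting the vertices $G$ and the trivial subgroup. The height of $L(G)$ is the length (number of strict inclusions) of a longest chain of subgroups from $G$ to $\{e\}$. A graph is bipartite if its vertex set can be partitioned into two (possibly empty) sets such that every edge joins a vertex of one to a vertex of the other. *)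

(* Defs.v *)
From HB Require Import structures.
From mathcomp Require Import all_boot all_fingroup all_solvable.

Set Implicit Arguments.
Unset Strict Implicit.
Unset Printing Implicit Defensive.

Local Open Scope group_scope.

Record sgraph := SGraph {
  vertex :> finType;
  edge : rel vertex;
  edge_sym : symmetric edge;
  edge_irrefl : irreflexive edge
}.

(* A and B may be empty. *)
Definition bipartite (g : sgraph) : Prop :=
  exists A B : {set g},
    [/\ A :|: B = [set: g], A :&: B = set0 &
        forall x y : g, edge x y ->
          (x \in A) && (y \in B) || (x \in B) && (y \in A)].

Definition graph_iso (g h : sgraph) : Prop :=
  exists2 f : g -> h, bijective f &
    forall x y : g, edge (f x) (f y) = edge x y.

Section DeleteVertices.
Variables (g : sgraph) (D : {set g}).

Let edge_del (x y : {x : g | x \notin D}) := edge (val x) (val y).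

Let edge_del_sym : symmetric edge_del.
Proof. by move=> x y; apply: edge_sym. Qed.

Let edge_del_irrefl : irreflexive edge_del.
Proof. by move=> x; apply: edge_irrefl. Qed.

Definition delete_vertices : sgraph := SGraph edge_del_sym edge_del_irrefl.

End DeleteVertices.

Section SubgroupGraphs.
Variables (gT : finGroupType) (G : {group gT}).

Definition nontriv_proper_subgroup (H : {group gT}) : bool :=
  [&& H \subset G, H :!=: 1 & H :!=: G].

Definition incl_adj (H K : {H : {group gT} | nontriv_proper_subgroup H}) :=
  (H != K) && ((val H \subset val K) || (val K \subset val H)).

Lemma incl_adj_sym : symmetric incl_adj.
Proof. by move=> H K; rewrite /incl_adj eq_sym orbC. Qed.

Lemma incl_adj_irrefl : irreflexive incl_adj.
Proof. by move=> H; rewrite /incl_adj eqxx. Qed.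

Definition inclusion_graph : sgraph := SGraph incl_adj_sym incl_adj_irrefl.

Definition hasse_adj (H K : {H : {group gT} | H \subset G}) :=
  maximal (val H) (val K) || maximal (val K) (val H).

Lemma hasse_adj_sym : symmetric hasse_adj.
Proof. by move=> H K; rewrite /hasse_adj orbC. Qed.

Lemma hasse_adj_irrefl : irreflexive hasse_adj.
Proof.
move=> H; rewrite /hasse_adj orbb; apply/negP => /maxgroupp.
by rewrite properxx.
Qed.

Definition subgroup_lattice : sgraph := SGraph hasse_adj_sym hasse_adj_irrefl.

Definition lattice_top : subgroup_lattice :=
  exist (fun H : {group gT} => H \subset G) G (subxx G).

Definition lattice_bot : subgroup_lattice :=
  exist (fun H : {group gT} => H \subset G) 1%G (sub1G G).

(* The sequence s lists a chain from 1 to G with the initial 1 omitted, so its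
   size is the number of strict inclusions. *)
Definition subgroup_chain (s : seq {group gT}) : bool :=
  path (fun H K : {group gT} => H \proper K) 1%G s && (last 1%G s == G).

Definition has_chain (n : nat) : bool :=
  [exists s : n.-tuple {group gT}, subgroup_chain s].

Lemma has_chain_ex : exists n, has_chain n.
Proof.
have [G1 | ntG] := eqVneq G 1%G.
  exists 0%N; apply/existsP; exists [tuple].
  by rewrite /subgroup_chain /= eq_sym G1.
exists 1%N; apply/existsP; exists [tuple G].
by rewrite /subgroup_chain /= eqxx !andbT properEneq eq_sym ntG sub1G.
Qed.

Lemma proper_path_card (s : seq {group gT}) (H : {group gT}) :
  path (fun H K : {group gT} => H \proper K) H s ->
  (size s + #|H| <= #|last H s|)%N.
Proof.
elim: s H => [|K s IHs] H //= /andP[/proper_card ltHK /IHs].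
by apply: leq_trans; rewrite addSnnS leq_add2l.
Qed.

Lemma has_chain_bound n : has_chain n -> (n <= #|G|)%N.
Proof.
case/existsP=> s /andP[/proper_path_card + /eqP lastG].
by rewrite lastG size_tuple; apply: leq_trans; apply: leq_addr.
Qed.

Definition lattice_height : nat := ex_maxn has_chain_ex has_chain_bound.

End SubgroupGraphs.

(* Main.v *)
Require Import Defs.
From mathcomp Require Import all_boot all_fingroup all_solvable.

(** The three conditions all say that no three nontrivial proper subgroups of
    [G] form a chain [H < K < L]; call such a triple a flag.

    - A flag is a triangle of the inclusion graph, so a bipartite inclusion
      graph has no flag.  Without flags, minimal vertices against the others is
      a bipartition: the lower end of an edge must be minimal.
    - Forgetting how subgroups are packaged, the Hasse diagram without its ends
      and the inclusion graph have the same vertices, and every Hasse edge is an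
      inclusion edge.  The two graphs coincide exactly when there are no flags.
      Condition (ii) only supplies some isomorphism, possibly unrelated to this
      identification, but an isomorphism forces equal numbers of edges, and
      then the inclusion of the edge sets is an equality
      ([iso_inj_hom_edge]).
    - Putting the trivial group below a flag and [G] above it gives a chain with
      four strict inclusions, and truncating a longer chain gives back a flag,
      so flags exist exactly when the height is at least [4]
      ([lattice_height_flag]).  The height is at least [2] because the graph has
      a vertex. *)

Set Implicit Arguments.
Unset Strict Implicit.
Unset Printing Implicit Defensive.

Local Open Scope group_scope.

Lemma bipartite_triangle_free (g : sgraph) (x y z : g) :
  bipartite g -> edge x y -> edge y z -> ~~ edge x z.
Proof.
case=> A [B [_ AB0 bip]] xy yz; apply/negP=> xz.
have disj u : ~~ ((u \in A) && (u \in B)) by rewrite -in_setI AB0 inE.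
move: (bip _ _ xy) (bip _ _ yz) (bip _ _ xz) (disj x) (disj y) (disj z).
by do 6!case: (_ \in _).
Qed.

(** Counting edges: the image of the edges of [g] under [phi] lies among the
    edges of [h], and the isomorphism says that both sets have the same size.
    Hence [phi], a priori only a homomorphism, also reflects edges. *)
Lemma iso_inj_hom_edge (g h : sgraph) (phi : g -> h) :
    graph_iso g h -> injective phi ->
    (forall x y, edge x y -> edge (phi x) (phi y)) ->
  forall x y, edge (phi x) (phi y) = edge x y.
Proof.
move=> [f f_bij fE] phi_inj phiE x y.
pose E (k : sgraph) := [set p : k * k | edge p.1 p.2].
pose dup (k : g -> h) (p : g * g) := (k p.1, k p.2).
have dup_inj k : injective k -> injective (dup k).
  by move=> k_inj [a b] [c d] [/k_inj-> /k_inj->].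
have cardE : #|E h| = #|E g|.
  have [f' fK f'K] := f_bij.
  suff -> : E h = dup f @: E g by rewrite card_imset //; apply/dup_inj/bij_inj.
  apply/setP=> -[a b]; rewrite inE /=; apply/idP/imsetP=> [ab | [[c d]]].
    exists (f' a, f' b); last by rewrite /dup /= !f'K.
    by rewrite inE /= -fE !f'K.
  by rewrite inE /= => cd [-> ->]; rewrite fE.
have imE : dup phi @: E g = E h.
  apply/eqP; rewrite eqEcard card_imset ?cardE ?leqnn ?andbT; last exact: dup_inj.
  by apply/subsetP=> _ /imsetP[[a b] + ->]; rewrite !inE; apply: phiE.
apply/idP/idP=> [xy | /phiE //].
have: (phi x, phi y) \in dup phi @: E g by rewrite imE inE.
by case/imsetP=> -[a b]; rewrite inE /= => ab [/phi_inj-> /phi_inj->].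
Qed.

Section Flags.
Variables (gT : finGroupType) (G : {group gT}).
Implicit Types H K L : {group gT}.

Definition has_flag : Prop := exists H K L,
  [/\ 1%G \proper H, H \proper K, K \proper L & L \proper G].

Lemma nontriv_proper_subgroupE H :
  nontriv_proper_subgroup G H = (1%G \proper H) && (H \proper G).
Proof.
rewrite /nontriv_proper_subgroup proper1G properEneq.
by rewrite andbC -andbA; congr (_ && _).
Qed.

Lemma last_proper_path_sub H (s : seq {group gT}) :
  path (fun H K : {group gT} => H \proper K) H s -> H \subset last H s.
Proof.
elim: s H => [|K s IHs] H //= /andP[/proper_sub sHK /IHs].
exact: subset_trans.
Qed.

Lemma leq_lattice_height n : has_chain G n -> n <= lattice_height G.
Proof. by rewrite /lattice_height; case: ex_maxnP => m _; apply. Qed.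

Lemma lattice_height_ge2 H :
  nontriv_proper_subgroup G H -> 2 <= lattice_height G.
Proof.
rewrite nontriv_proper_subgroupE => /andP[ltH ltHG]; apply: leq_lattice_height.
by apply/existsP; exists [tuple H; G]; rewrite /subgroup_chain /= ltH ltHG /=.
Qed.

Lemma lattice_height_flag : has_flag <-> 4 <= lattice_height G.
Proof.
split=> [[H [K [L [lt1H ltHK ltKL ltLG]]]]|].
  apply: leq_lattice_height; apply/existsP; exists [tuple H; K; L; G].
  by rewrite /subgroup_chain /= lt1H ltHK ltKL ltLG /=.
rewrite /lattice_height; case: ex_maxnP => n /existsP[[s /= /eqP <-]] + _.
case: s => [|H [|K [|L [|M s]]]] // /andP[/= /and5P[lt1H ltHK ltKL ltLM s_path]].
move=> /eqP lastG _; exists H, K, L; split=> //.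
by apply: proper_sub_trans ltLM _; rewrite -lastG; apply: last_proper_path_sub.
Qed.

Lemma inclusion_edge (H K : inclusion_graph G) :
  edge H K = (val H \proper val K) || (val K \proper val H).
Proof.
by rewrite /= /incl_adj !properEneq -!val_eqE /= eq_sym -andb_orr eq_sym.
Qed.

Lemma bipartite_no_flag : bipartite (inclusion_graph G) -> ~ has_flag.
Proof.
move=> bip [H [K [L [lt1H ltHK ltKL ltLG]]]].
have ltHL := proper_trans ltHK ltKL; have ltKG := proper_trans ltKL ltLG.
have vH : nontriv_proper_subgroup G H.
  by rewrite nontriv_proper_subgroupE lt1H (proper_trans ltHK).
have vK : nontriv_proper_subgroup G K.
  by rewrite nontriv_proper_subgroupE ltKG (proper_trans lt1H).
have vL : nontriv_proper_subgroup G L.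
  by rewrite nontriv_proper_subgroupE ltLG (proper_trans lt1H).
pose v M (vM : nontriv_proper_subgroup G M) : inclusion_graph G := Sub M vM.
have := @bipartite_triangle_free _ (v H vH) (v K vK) (v L vL) bip.
by rewrite !inclusion_edge /= ltHK ltKL ltHL => /(_ isT isT).
Qed.

Lemma no_flag_bipartite : ~ has_flag -> bipartite (inclusion_graph G).
Proof.
move=> noflag.
pose A := [set H : inclusion_graph G |
             [forall K : inclusion_graph G, ~~ (val K \proper val H)]].
exists A, (~: A); split; [exact: setUCr | exact: setICr |].
have lower (H K : inclusion_graph G) :
    val H \proper val K -> (H \in A) && (K \in ~: A).
  move=> ltHK; rewrite !inE; apply/andP; split; last first.
    by apply/forallPn; exists H; rewrite negbK.
  (* A vertex below [H] would complete [H < K] to a flag. *)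
  apply/forallP=> M; apply/negP=> ltMH; apply: noflag.
  have := valP M; rewrite nontriv_proper_subgroupE => /andP[lt1M _].
  have := valP K; rewrite nontriv_proper_subgroupE => /andP[_ ltKG].
  by exists (val M), (val H), (val K).
move=> H K; rewrite inclusion_edge => /orP[/lower-> // | /lower].
by rewrite andbC => ->; rewrite orbT.
Qed.

Local Notation inner_lattice :=
  (delete_vertices [set lattice_top G; lattice_bot G]).

Lemma inner_lattice_vertex (H : subgroup_lattice G) :
  (H \notin [set lattice_top G; lattice_bot G])
    = nontriv_proper_subgroup G (val H).
Proof.
rewrite !inE negb_or /nontriv_proper_subgroup (valP H) /= andbC.
by rewrite -!val_eqE.
Qed.

Lemma inner_lattice_valP (x : inner_lattice) :
  nontriv_proper_subgroup G (val (val x)).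
Proof. by rewrite -inner_lattice_vertex; apply: (valP x). Qed.

(** The vertices of both graphs are the nontrivial proper subgroups; this is
    the identity between the two ways of packaging them. *)
Definition inner_to_inclusion (x : inner_lattice) : inclusion_graph G :=
  Sub (val (val x)) (inner_lattice_valP x).

Lemma inner_to_inclusion_inj : injective inner_to_inclusion.
Proof. by move=> x y [] eq_xy; apply/val_inj/val_inj. Qed.

Lemma inner_to_inclusion_bij : bijective inner_to_inclusion.
Proof.
have surj (H : inclusion_graph G) : exists x, inner_to_inclusion x == H.
  have sHG : val H \subset G by have /and3P[] := valP H.
  pose K : subgroup_lattice G := Sub (val H) sHG.
  have vK : K \notin [set lattice_top G; lattice_bot G].
    by rewrite inner_lattice_vertex; apply: (valP H).
  by exists (Sub K vK : inner_lattice); rewrite -val_eqE.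
exists (fun H : inclusion_graph G => xchoose (surj H)) => [x | H].
  exact/inner_to_inclusion_inj/eqP/(xchooseP (surj _)).
exact/eqP/(xchooseP (surj H)).
Qed.

Lemma inner_lattice_edge (x y : inner_lattice) :
  edge x y = maximal (val (val x)) (val (val y))
             || maximal (val (val y)) (val (val x)).
Proof. by []. Qed.

Lemma inner_to_inclusion_hom (x y : inner_lattice) :
  edge x y -> edge (inner_to_inclusion x) (inner_to_inclusion y).
Proof.
rewrite inner_lattice_edge inclusion_edge /=.
by case/orP=> /maxgroupp ->; rewrite ?orbT.
Qed.

(** A subgroup strictly between the ends of an inclusion edge would make a
    flag, so without flags every inclusion edge is a covering relation. *)
Lemma no_flag_iso :
  ~ has_flag -> graph_iso inner_lattice (inclusion_graph G).
Proof.
move=> noflag; exists inner_to_inclusion; first exact: inner_to_inclusion_bij.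
have max (x y : inner_lattice) :
    val (val x) \proper val (val y) -> maximal (val (val x)) (val (val y)).
  move=> ltxy; apply/maxgroupP; split=> // M ltMy sxM.
  apply/eqP; rewrite eq_sym; apply/negPn/negP=> neqxM; apply: noflag.
  have := inner_lattice_valP x.
  rewrite nontriv_proper_subgroupE => /andP[lt1x _].
  have := inner_lattice_valP y.
  rewrite nontriv_proper_subgroupE => /andP[_ ltyG].
  exists (val (val x)), M, (val (val y)); split=> //.
  by rewrite properEneq neqxM.
move=> x y; apply/idP/idP; last exact: inner_to_inclusion_hom.
rewrite inclusion_edge inner_lattice_edge /=.
by case/orP=> /max ->; rewrite ?orbT.
Qed.

(** The ends [H < L] of a flag are joined in the inclusion graph, but the
    middle term shows that [H] is not maximal in [L]; so the Hasse diagram has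
    strictly fewer edges. *)
Lemma iso_no_flag :
  graph_iso inner_lattice (inclusion_graph G) -> ~ has_flag.
Proof.
move=> iso [H [K [L [lt1H ltHK ltKL ltLG]]]].
have ltHL := proper_trans ltHK ltKL.
have vH : nontriv_proper_subgroup G H.
  by rewrite nontriv_proper_subgroupE lt1H (proper_trans ltHL).
have vL : nontriv_proper_subgroup G L.
  by rewrite nontriv_proper_subgroupE ltLG (proper_trans lt1H).
have [inv _ invK] := inner_to_inclusion_bij.
pose x := inv (Sub H vH); pose y := inv (Sub L vL).
have xE : val (val x) = H by have /(congr1 val) := invK (Sub H vH).
have yE : val (val y) = L by have /(congr1 val) := invK (Sub L vL).
have := iso_inj_hom_edge iso inner_to_inclusion_inj inner_to_inclusion_hom x y.
rewrite inclusion_edge inner_lattice_edge /= xE yE ltHL /=.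
case/esym/orP=> [/maxgroupP[_ maxH] | /maxgroupp ltLH].
  by have := ltHK; rewrite (maxH K ltKL (proper_sub ltHK)) properxx.
by have := proper_trans ltHL ltLH; rewrite properxx.
Qed.

End Flags.

Theorem theorem2p7 (gT : finGroupType) (G : {group gT})
    (G_nonempty : exists H : {group gT}, nontriv_proper_subgroup G H) :
  [<-> bipartite (inclusion_graph G);
       graph_iso
         (delete_vertices [set lattice_top G; lattice_bot G])
         (inclusion_graph G);
       lattice_height G = 2 \/ lattice_height G = 3].
Proof.
tfae.
- by move=> /bipartite_no_flag/no_flag_iso.
- move=> /iso_no_flag noflag; have [H /lattice_height_ge2] := G_nonempty.
  have := lattice_height_flag G.
  case: (lattice_height G) => [|[|[|[|n]]]] //; [by left | by right |].
  by case=> _ flag; case: noflag; apply: flag.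
- by move=> height; apply/no_flag_bipartite=> /lattice_height_flag; case: height => ->.
Qed.
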